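(* Let $\mu$ be a dominant coweight for $GL_n$, and let $I\subseteq\mathbb{Z}$ be the inverse image of a non-empty subset $\overline I\subseteq\mathbb{Z}/n\mathbb{Z}$. Then $\mathrm{Perm}_I(\mu)=\mathrm{Adm}_I(\mu)$.
   Context: A dominant coweight for $GL_n$ is $\mu=(\mu(1),\dots,\mu(n))\in\mathbb{Z}^n$ with $\mu(1)\ge\dots\ge\mu(n)$. $P_\mu\subset\mathbb{R}^n$ is the convex hull of the $S_n$-orbit of $\mu$. For $v\in\mathbb{Z}^n$, $\sum(v)$ is the sum of its coordinates; $\le$ on $\mathbb{Z}^n$ is coordinatewise; $\mathbf{1}=(1,\dots,1)$. Faces: for a non-empty subset $\overline I\subseteq\mathbb{Z}/n\mathbb{Z}$ with inverse image $I\subseteq\mathbb{Z}$, a face of type $I$ is a family $(v_i)_{i\in I}$, $v_i\in\mathbb{Z}^n$, with (1) $v_{i+n}=v_i+\mathbf{1}$ for all $i\in I$; (2) $v_i\le v_j$ for all $i\le j$ in $I$; (3) $\sum(v_i)-\sum(v_j)=i-j$ for all $i,j\in I$. $\mathcal{F}_I$ is the set of faces of type $I$; faces of type $\mathbb{Z}$ (i.e. $\overline I=\mathbb{Z}/n\mathbb{Z}$) are called alcoves. Let $\omega_i=(1^i,0^{n-i})$ for $0\le i\le n-1$ and $\omega_{i+n}=\omega_i+\mathbf{1}$; $\omega=(\omega_i)_i$ is the standard (base) alcove. Extended affine Weyl group: $\widetilde W=\mathbb{Z}^n\rtimes S_n$ acts on $\mathbb{Z}^n$ by translations and coordinate permutations;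 $t_\lambda$ is translation by $\lambda$. It acts on $\mathcal{F}_I$ by $x(v_i)_i=(x(v_i))_i$; $x\mapsto(x(\omega_i))_{i\in\mathbb{Z}}$ identifies $\widetilde W$ with the set of alcoves, and $\mathcal{F}_I$ is identified with $\widetilde W/W_I$, $W_I$ being the stabilizer of $(\omega_i)_{i\in I}$. The affine Weyl group $W_{\rm aff}\subset\widetilde W$ is the Coxeter group generated by the reflections in the walls of the base alcove, i.e. by the transpositions $s_i$ of coordinates $i,i+1$ ($1\le i\le n-1$) and $s_0:(x_1,\dots,x_n)\mapsto(x_n+1,x_2,\dots,x_{n-1},x_1-1)$. With $\Omega\subset\widetilde W$ the stabilizer of the base alcove (elements mapping the set $\{\omega_i\}_{i\in\mathbb Z}$ to itself), $\widetilde W=W_{\rm aff}\rtimes\Omega$, and the Bruhat order on $\widetilde W$ is: $w\tau\le w'\tau'$ ($w,w'\in W_{\rm aff}$, $\tau,\tau'\in\Omega$) iff $\tau=\tau'$ and $w\le w'$ in $W_{\rm aff}$. Permissible and admissible sets: $\mathrm{Perm}_I(\mu)=\{(v_i)_{i\in I}\in\mathcal{F}_I: v_i-\omega_i\in P_\mu\text{ for all }i\in I\}$. $\mathrm{Adm}(\mu)=\{x\in\widetilde W: x\le t_{w\mu}\text{ for some }w\in S_n\}$, and $\mathrm{Adm}_I(\mu)\subseteq\mathcal{F}_I$ is the image of $\mathrm{Adm}(\mu)$ under $\widetilde W\cong\mathcal{F}_{\mathbb{Z}}\to\mathcal{F}_I$, $(v_i)_{i\in\mathbb{Z}}\mapsto(v_i)_{i\in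 I}$. *)

(* Defs.v *)
From HB Require Import structures.
From mathcomp Require Import all_boot all_order all_algebra all_fingroup.
From mathcomp Require Import boolp classical_sets reals convex.
From Stdlib Require Import Relation_Operators.

Set Implicit Arguments.
Unset Strict Implicit.
Unset Printing Implicit Defensive.

Import Order.TTheory GRing.Theory Num.Theory.

Local Open Scope classical_set_scope.
Local Open Scope ring_scope.

(* Coordinates are 0-based: the coordinate x_i (1 <= i <= n) has index i - 1
   in 'I_n.  The symmetric group acts by [col_perm s v], that is
   (s v)_j = v_(s j); since (s * t) j = t (s j) for permutations, this is a
   left action of 'S_n. *)

Section Vectors.
Variable n : nat.

Definition vsum (v : 'rV[int]_n) : int := \sum_(j < n) v 0 j.

Definition vle (v w : 'rV[int]_n) : Prop := forall j : 'I_n, v 0 j <= w 0 j.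

Definition dominant (mu : 'rV[int]_n) : Prop :=
  forall i j : 'I_n, (i <= j)%N -> mu 0 j <= mu 0 i.

Definition orbit_polytope (R : realType) (mu : 'rV[int]_n) : set 'rV[R]_n :=
  smallest (@convex_set R 'rV[R]_n)
    (range (fun s : 'S_n => map_mx intr (col_perm s mu))).

End Vectors.

Arguments orbit_polytope {n} R mu _.

(* The extended affine Weyl group as a semidirect product: [AffPerm l s] is
   the transformation v |-> l + s v. *)
Record affPerm (n : nat) := AffPerm {
  transl : 'rV[int]_n;
  linpart : 'S_n
}.

Section AffPermGroup.
Variable n : nat.
Implicit Types x y z : affPerm n.

Definition pair_of_affPerm x := (transl x, linpart x).
Definition affPerm_of_pair (p : 'rV[int]_n * 'S_n) := AffPerm p.1 p.2.

Lemma pair_of_affPermK : cancel pair_of_affPerm affPerm_of_pair.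
Proof. by case. Qed.

HB.instance Definition _ :=
  Choice.copy (affPerm n) (can_type pair_of_affPermK).

Definition affPerm1 : affPerm n := AffPerm 0 1%g.
Definition affPermM x y : affPerm n :=
  AffPerm (transl x + col_perm (linpart x) (transl y))
          (linpart x * linpart y)%g.
Definition affPermV x : affPerm n :=
  AffPerm (- col_perm (linpart x)^-1%g (transl x)) (linpart x)^-1%g.

Lemma affPermMA : associative affPermM.
Proof.
move=> x y z; rewrite /affPermM /= mulgA; congr AffPerm.
by apply/rowP=> j; rewrite !mxE permM addrA.
Qed.

Lemma affPerm1M : left_id affPerm1 affPermM.
Proof.
case=> l s; rewrite /affPermM /= mul1g; congr AffPerm.
by apply/rowP=> j; rewrite !mxE perm1 add0r.
Qed.

Lemma affPermM1 : right_id affPerm1 affPermM.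
Proof.
case=> l s; rewrite /affPermM /= mulg1; congr AffPerm.
by apply/rowP=> j; rewrite !mxE addr0.
Qed.

Lemma affPermVM : left_inverse affPerm1 affPermV affPermM.
Proof.
case=> l s; rewrite /affPermM /= mulVg; congr AffPerm.
by apply/rowP=> j; rewrite !mxE addNr.
Qed.

Lemma affPermMV : right_inverse affPerm1 affPermV affPermM.
Proof.
case=> l s; rewrite /affPermM /= mulgV; congr AffPerm.
by apply/rowP=> j; rewrite !mxE -permM mulgV perm1 subrr.
Qed.

HB.instance Definition _ := isGroup.Build (affPerm n)
  affPermMA affPerm1M affPermM1 affPermVM affPermMV.

Definition act x (v : 'rV[int]_n) : 'rV[int]_n :=
  transl x + col_perm (linpart x) v.

Lemma act1 v : act 1%g v = v.
Proof. by apply/rowP=> j; rewrite !mxE perm1 add0r. Qed.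

Lemma actM x y v : act (x * y)%g v = act x (act y v).
Proof. by apply/rowP=> j; rewrite !mxE permM addrA. Qed.

Definition translation (l : 'rV[int]_n) : affPerm n := AffPerm l 1%g.

End AffPermGroup.

Section Bruhat.
Variable n : nat.
Implicit Types u w x y : affPerm n.

(* The left disjunct gives s_1, .., s_(n-1).  The right one gives s_0, as
   e_1 - e_n + (1 n); the condition [i < j] makes it void for n = 1, where
   the base alcove has no wall. *)
Definition simple_reflection : set (affPerm n) :=
  [set s | (exists i j : 'I_n,
              nat_of_ord j = i.+1 /\ s = AffPerm 0 (tperm i j)) \/
           (exists i j : 'I_n,
              [/\ nat_of_ord i = 0%N, j.+1 = n, (i < j)%N &
                  s = AffPerm (delta_mx 0 i - delta_mx 0 j) (tperm i j)])].

(* [w] is a product of [k] simple reflections.  These are involutions, so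
   inverses are not needed in the definition of [Waff]. *)
Definition expressible w (k : nat) : Prop :=
  exists s : seq (affPerm n),
    [/\ size s = k, (forall r, r \in s -> simple_reflection r) &
        w = (\prod_(r <- s) r)%g].

Definition Waff : set (affPerm n) := [set w | exists k, expressible w k].

Definition has_length w (k : nat) : Prop :=
  expressible w k /\ forall m, expressible w m -> (k <= m)%N.

Definition reflection : set (affPerm n) :=
  [set t | exists w s,
     [/\ Waff w, simple_reflection s & t = (w * s * w^-1)%g]].

Definition bruhat_step u w : Prop :=
  exists t k l, [/\ reflection t, w = (u * t)%g,
                    has_length u k, has_length w l & (k < l)%N].

Definition bruhat_aff : affPerm n -> affPerm n -> Prop :=
  clos_refl_trans (affPerm n) bruhat_step.

(* For i = q n + r with 0 <= r < n: omega_i = (1^r, 0^(n-r)) + q (1,..,1). *)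
Definition omega (i : int) : 'rV[int]_n :=
  \row_(j < n) ((i %/ n)%Z + (if j%:Z < (i %% n)%Z then 1 else 0)).

Definition Omega : set (affPerm n) :=
  [set x | act x @` range omega = range omega].

Definition bruhat x y : Prop :=
  exists w w' tau, [/\ Waff w, Waff w' & Omega tau] /\
    [/\ x = (w * tau)%g, y = (w' * tau)%g & bruhat_aff w w'].

Definition Adm (mu : 'rV[int]_n) : set (affPerm n) :=
  [set x | exists s : 'S_n, bruhat x (translation (col_perm s mu))].

End Bruhat.

Section Faces.
Variable n : nat.

(* For n > 0 the elements of 'I_n represent the residue classes modulo n. *)
Definition preimZ (Ibar : {set 'I_n}) : pred int :=
  fun i => [exists r in Ibar, (i == r%:Z %[mod n])%Z].

Definition family (Ibar : {set 'I_n}) : Type :=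
  {i : int | preimZ Ibar i} -> 'rV[int]_n.

Definition is_face (Ibar : {set 'I_n}) : set (family Ibar) :=
  [set v | [/\ forall i j, val j = val i + n%:Z -> v j = v i + const_mx 1,
               forall i j, val i <= val j -> vle (v i) (v j) &
               forall i j, vsum (v i) - vsum (v j) = val i - val j]].

Definition face_of (Ibar : {set 'I_n}) (x : affPerm n) : family Ibar :=
  fun i => act x (omega n (val i)).

Definition PermI (R : realType) (Ibar : {set 'I_n}) (mu : 'rV[int]_n) :
    set (family Ibar) :=
  [set v | is_face v /\
           forall i, orbit_polytope R mu (map_mx intr (v i - omega n (val i)))].

Definition AdmI (Ibar : {set 'I_n}) (mu : 'rV[int]_n) : set (family Ibar) :=
  @face_of Ibar @` Adm mu.

End Faces.

Arguments PermI {n} R Ibar mu _.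
Arguments AdmI {n} Ibar mu _.

(* Main.v *)
(* A vector v is encoded by the function of a in Z with values v_a for
   0 <= a < n that decreases by 1 when a grows by n, and an element of the
   extended affine Weyl group by an affine permutation of Z; the Bruhat order
   is then generated by swapping the values at a < b which are in increasing
   order.  That x <= t_(w mu) implies permissibility holds reflection by
   reflection: x om_i - om_i lies on the segment between y om_i - om_i and its
   image under the linear part of the reflection leading from x to y.

   Conversely, let v be a permissible face.  Fix one vertex of v; the direction
   from the base alcove to it determines a Weyl chamber, hence a w, such that
   every v_i lies in a cone at om_i close to that chamber.  Inside this cone,
   the partial sums of v_i - om_i in the order w being at most those of mu
   suffices to reach om_i + w mu by upward reflections, for each i separately.
   An argument of Deodhar combines these comparisons of vertices into a lift x
   of the face with x <= t_(w mu). *)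
From Pilot Require Import Defs.
From mathcomp Require Import all_boot all_order all_algebra all_fingroup.
From mathcomp Require Import boolp classical_sets reals convex.
From mathcomp Require Import interval_inference.
From mathcomp Require Import zify ring lra.
From Stdlib Require Import Relation_Operators.
Import Pilot.Defs.

Set Implicit Arguments.
Unset Strict Implicit.
Unset Printing Implicit Defensive.

Import Order.TTheory GRing.Theory Num.Theory.

Local Open Scope ring_scope.

(** * Affine permutations *)

Section Extension.
Variables (n : nat) (n_gt0 : (0 < n)%N).
Implicit Types (v : 'rV[int]_n) (x y u w t : affPerm n) (a b c q : int).

Lemma modz_ltn c : (`|(c %% n)%Z| < n)%N.
Proof.
by rewrite -ltz_nat gez0_abs ?ltz_pmod ?modz_ge0 //; lia.
Qed.

Definition res c : 'I_n := Ordinal (modz_ltn c).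
Definition quo c : int := (c %/ n)%Z.

Lemma divz_res c : c = (res c)%:Z + quo c * n.
Proof.
rewrite /= /quo gez0_abs; last by apply: modz_ge0; lia.
by rewrite addrC -divz_eq.
Qed.

Lemma res_quo_unique (r : 'I_n) (q : int) :
  res (r%:Z + q * n) = r /\ quo (r%:Z + q * n) = q.
Proof.
have rn := ltn_ord r; have r0 : (r%:Z %/ n)%Z = 0 by apply: divz_small; lia.
have rr : (r%:Z %% n)%Z = r by apply: modz_small; lia.
split; last by rewrite /quo addrC divzMDl ?r0 ?addr0 //; lia.
by apply/val_inj; rewrite /= addrC modzMDl rr.
Qed.

Lemma res_ord (r : 'I_n) : res r%:Z = r.
Proof. by have [+ _] := res_quo_unique r 0; rewrite mul0r addr0. Qed.

Lemma quo_ord (r : 'I_n) : quo r%:Z = 0.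
Proof. by have [_] := res_quo_unique r 0; rewrite mul0r addr0. Qed.

Lemma res_shift c q : res (c + q * n) = res c.
Proof.
have [+ _] := res_quo_unique (res c) (quo c + q).
by rewrite mulrDl addrA -divz_res.
Qed.

Lemma quo_shift c q : quo (c + q * n) = quo c + q.
Proof.
have [_] := res_quo_unique (res c) (quo c + q).
by rewrite mulrDl addrA -divz_res.
Qed.

Lemma eq_resP a b : reflect (exists q : int, a = b + q * n) (res a == res b).
Proof.
apply: (iffP eqP) => [ab|[q ->]]; last exact: res_shift.
by exists (quo a - quo b); rewrite {1}(divz_res a) {1}(divz_res b) ab; ring.
Qed.

Lemma eq_res_add a b c : (res (a + c) == res (b + c)) = (res a == res b).
Proof.
by apply/eq_resP/eq_resP => -[q e]; exists q; [apply: (addIr c)|]; rewrite e; ring.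
Qed.

(* A vector is encoded by the function of a in Z with value v_a on 0 .. n-1
   that decreases by 1 when a grows by n; the affine roots then become the
   differences of the values at a < b, which are non-negative on the base
   alcove. *)
Definition ext v c : int := v 0 (res c) - quo c.

Lemma ext_shift v c q : ext v (c + q * n) = ext v c - q.
Proof. by rewrite /ext res_shift quo_shift; ring. Qed.

Lemma ext_ord v (r : 'I_n) : ext v r%:Z = v 0 r.
Proof. by rewrite /ext res_ord quo_ord subr0. Qed.

Lemma ext_inj v v' : ext v =1 ext v' -> v = v'.
Proof. by move=> e; apply/rowP=> j; rewrite -!ext_ord e. Qed.

(** In this encoding the i-th base vertex is the step function that drops by one at each integer
    congruent to i modulo n; in particular it is antitone. *)
Lemma ext_omega i c : ext (omega n i) c = - ((c - i) %/ n)%Z.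
Proof.
rewrite /ext mxE.
rewrite [in RHS](divz_res c) [in RHS](divz_eq i n).
set r := (i %% n)%Z; set q := (i %/ n)%Z; set p := res c.
have r0 : 0 <= r by apply: modz_ge0; lia.
have rn : r < n by apply: ltz_pmod; lia.
have -> : p%:Z + quo c * n - (q * n + r) = (quo c - q) * n + (p%:Z - r) by ring.
rewrite divzMDl; last by lia.
case: ifP => pr.
  have -> : p%:Z - r = (-1) * n%:Z + (p%:Z - r + n) by ring.
  rewrite divzMDl; last by lia.
  rewrite (@divz_small (_ + _)); first by ring.
  by have := ltn_ord p; lia.
rewrite divz_small; first by ring.
by have := ltn_ord p; lia.
Qed.

Lemma ext_omega_ge i a b : a <= b -> ext (omega n i) b <= ext (omega n i) a.
Proof. by move=> ab; rewrite !ext_omega lerN2; apply: lez_pdiv2r; lia. Qed.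

(** The bijection of Z for which acting by x precomposes [ext v] with it ([ext_act]). Precomposition
    reverses products, hence the order in [afunM]. *)
Definition afun x c : int :=
  (linpart x (res c))%:Z + (quo c - transl x 0 (res c)) * n.

Lemma afun_shift x c q : afun x (c + q * n) = afun x c + q * n.
Proof. by rewrite /afun res_shift quo_shift; ring. Qed.

Lemma res_afun x c : res (afun x c) = linpart x (res c).
Proof. by rewrite /afun res_shift res_ord. Qed.

Lemma quo_afun x c : quo (afun x c) = quo c - transl x 0 (res c).
Proof. by rewrite /afun quo_shift quo_ord add0r. Qed.

Lemma ext_act x v c : ext (act x v) c = ext v (afun x c).
Proof. by rewrite /ext res_afun quo_afun !mxE; ring. Qed.

Lemma afunM x y c : afun (x * y)%g c = afun y (afun x c).
Proof. by rewrite {2}/afun res_afun quo_afun {1}/afun /= permM !mxE; ring. Qed.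

Lemma afun1 c : afun 1%g c = c.
Proof. by rewrite /afun /= perm1 mxE subr0 -divz_res. Qed.

Lemma afunK x : cancel (afun x) (afun x^-1%g).
Proof. by move=> c; rewrite -afunM mulgV afun1. Qed.

Lemma afunKV x : cancel (afun x^-1%g) (afun x).
Proof. by move=> c; rewrite -afunM mulVg afun1. Qed.

Lemma afun_inj x : injective (afun x).
Proof. exact: can_inj (afunK x). Qed.

Lemma eq_affPerm x y : afun x =1 afun y -> x = y.
Proof.
move=> e; have er (r : 'I_n) : linpart x r = linpart y r.
  by have := congr1 res (e r%:Z); rewrite !res_afun res_ord.
have et (r : 'I_n) : transl x 0 r = transl y 0 r.
  by have := congr1 quo (e r%:Z); rewrite !quo_afun res_ord => /addrI /oppr_inj.
case: x y er et {e} => [l s] [l' s'] /= er et; congr AffPerm.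
  by apply/rowP.
exact/permP.
Qed.

Lemma eq_res_afun x a b : (res (afun x a) == res (afun x b)) = (res a == res b).
Proof. by rewrite !res_afun (inj_eq perm_inj). Qed.

Definition swp a b c : int :=
  if res c == res a then c + (b - a)
  else if res c == res b then c + (a - b) else c.

(** For a and b in different classes this is the affine reflection exchanging a + qn and b + qn for
    all q; the translation part accounts for a and b lying in different periods. *)
Definition refl a b : affPerm n :=
  AffPerm ((quo a - quo b) *: (delta_mx 0 (res a) - delta_mx 0 (res b)))
          (tperm (res a) (res b)).

Lemma afun_refl a b c : res a != res b -> afun (refl a b) c = swp a b c.
Proof.
move=> ab; rewrite /afun /swp /= !mxE eqxx /=.
have := divz_res a; have := divz_res b; have := divz_res c.
move: (quo c) (quo a) (quo b) => qc qa qb.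
have [ca ec ea eb|ca] := eqVneq (res c) (res a).
  by rewrite ca tpermL (negbTE ab) /= [in RHS]ec [in RHS]ea [in RHS]eb ca; ring.
have [cb ec ea eb|cb ec _ _] := eqVneq (res c) (res b).
  by rewrite cb tpermR /= [in RHS]ec [in RHS]ea [in RHS]eb cb; ring.
by rewrite tpermD 1?eq_sym //= {2}ec; ring.
Qed.

Lemma swpL a b : swp a b a = b.
Proof. by rewrite /swp eqxx addrC subrK. Qed.

Lemma swpR a b : res a != res b -> swp a b b = a.
Proof. by rewrite /swp eq_sym => /negbTE ->; rewrite eqxx addrC subrK. Qed.

Lemma swp_afun x a b c : swp (afun x a) (afun x b) (afun x c) = afun x (swp a b c).
Proof.
rewrite /swp !eq_res_afun; case: eq_resP => [[q ->]|_].
  have -> : a + q * n + (b - a) = b + q * n by ring.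
  by rewrite !afun_shift; ring.
case: eq_resP => [[q ->]|//].
have -> : b + q * n + (a - b) = a + q * n by ring.
by rewrite !afun_shift; ring.
Qed.

Lemma refl_afun x a b : res a != res b ->
  refl (afun x a) (afun x b) = (x^-1 * refl a b * x)%g.
Proof.
move=> ab; apply: eq_affPerm => c.
rewrite afun_refl ?eq_res_afun // !afunM afun_refl //.
by rewrite -swp_afun afunKV.
Qed.

Lemma refl_shift a b q : refl (a + q * n) (b + q * n) = refl a b.
Proof.
rewrite /refl !res_shift !quo_shift.
by have -> : quo a + q - (quo b + q) = quo a - quo b by ring.
Qed.

Lemma refl_invol a b : res a != res b -> (refl a b * refl a b)%g = 1%g.
Proof.
move=> ab; apply: eq_affPerm => c; rewrite afunM afun1.
case: (eq_resP c a) => [[q ->]|/eq_resP/negbTE ca].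
  by rewrite (afun_shift _ a) (afun_refl a ab) swpL afun_shift afun_refl // swpR.
case: (eq_resP c b) => [[q ->]|/eq_resP/negbTE cb].
  by rewrite (afun_shift _ b) (afun_refl b ab) swpR // afun_shift afun_refl // swpL.
by rewrite !afun_refl // /swp ca cb ca cb.
Qed.

Lemma reflV a b : res a != res b -> (refl a b)^-1%g = refl a b.
Proof. by move=> ab; apply: (mulgI (refl a b)); rewrite mulgV refl_invol. Qed.

(** * Orders generated by reflections *)

Definition adjacent c : bool := res c != res (c + 1).

(** A pair a < b in distinct classes stands for a positive affine root; a simple reflection makes no
    positive root negative except its own. *)
Lemma swp_adjacent a b c : adjacent c -> a < b -> res a != res b ->
  swp c (c + 1) a < swp c (c + 1) b \/ refl a b = refl c (c + 1).
Proof.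
rewrite /adjacent => cc ab rab; rewrite /swp.
have [ac|ac] := eqVneq (res a) (res c).
  rewrite -ac eq_sym (negbTE rab).
  have acc : res (a + 1) = res (c + 1) by apply/eqP; rewrite eq_res_add ac.
  have [bc|bc] := eqVneq (res b) (res (c + 1)).
    have [ba|ba] := eqVneq b (a + 1).
      have /eq_resP[q aE] : res a == res c by apply/eqP.
      by right; rewrite ba aE addrAC refl_shift.
    have ba2 : b != a + 1 + 1.
      apply: contra cc => /eqP ba2.
      by rewrite -ac -acc -(eq_res_add _ _ 1) -ba2 bc acc.
    by left; move/eqP: ba; move/eqP: ba2; lia.
  have ba : b != a + 1 by apply: contra bc => /eqP ->; rewrite acc.
  by left; move/eqP: ba; lia.
have [ac1|ac1] := eqVneq (res a) (res (c + 1)).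
  rewrite -ac1 [res b == res a]eq_sym (negbTE rab).
  by left; case: ifP; lia.
left; case: ifP => [_|/negbT bc]; first by lia.
case: ifP => [bc1|_]; last by lia.
have ba : b != a + 1.
  by apply: contra ac => /eqP ba; rewrite -(eq_res_add _ _ 1) -ba bc1.
by move/eqP: ba; lia.
Qed.

Section ReflectionOrder.
Variables (X : Type) (op : affPerm n -> X -> X) (e : X -> int -> int).
Hypotheses (opM : forall x y p, op (x * y)%g p = op x (op y p))
  (op1 : forall p, op 1%g p = p)
  (op_id : forall a b p, res a != res b -> e p a = e p b -> op (refl a b) p = p)
  (eop : forall x p c, e (op x p) c = e p (afun x c)).
Implicit Types p r : X.

(** [X] is abstract to serve twice: for vectors with [ext], and for the group under left
    multiplication with minus [afun]. *)
Definition rstep p r := exists a b,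
  [/\ a < b, res a != res b, e p b < e p a & r = op (refl a b) p].
Definition rle := clos_refl_trans X rstep.

Lemma op_refl_invol a b p : res a != res b -> op (refl a b) (op (refl a b) p) = p.
Proof. by move=> ab; rewrite -opM refl_invol // op1. Qed.

Lemma e_refl a b p c : res a != res b -> e (op (refl a b) p) c = e p (swp a b c).
Proof. by move=> ab; rewrite eop afun_refl. Qed.

(** Conjugation by the simple reflection keeps the root of the step positive, unless the step is
    that reflection itself. *)
Lemma rstep_adjacent c p r : adjacent c -> rstep p r ->
  r = op (refl c (c + 1)) p \/
  rstep (op (refl c (c + 1)) p) (op (refl c (c + 1)) r).
Proof.
move=> cc [a [b [ab rab eab ->]]]; set s := refl c (c + 1).
have [lt_s|->] := swp_adjacent cc ab rab; last by left.
have rss := refl_invol cc; have sV := reflV cc.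
right; exists (swp c (c + 1) a), (swp c (c + 1) b).
rewrite -!afun_refl // eq_res_afun; split=> //.
- by rewrite !afun_refl.
- by rewrite !eop -!afunM rss !afun1.
by rewrite (refl_afun _ rab) sV -/s !opM -(opM s s) rss op1.
Qed.

(** [pmin] and [pmax] select the lower and the upper one of p and its mirror image; their
    monotonicity is the lifting property of the Bruhat order. *)
Definition pmin c p := if e p (c + 1) <= e p c then p else op (refl c (c + 1)) p.
Definition pmax c p := if e p (c + 1) <= e p c then op (refl c (c + 1)) p else p.

Lemma rle_up c p : adjacent c -> e p (c + 1) <= e p c ->
  rle p (op (refl c (c + 1)) p).
Proof.
move=> cc; rewrite le_eqVlt => /predU1P[/esym epc|lt_e].
  by rewrite op_id //; exact: rt_refl.
by apply: rt_step; exists c, (c + 1); split=> //; lia.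
Qed.

Lemma rle_down c p : adjacent c -> e p c <= e p (c + 1) ->
  rle (op (refl c (c + 1)) p) p.
Proof.
move=> cc le_e; rewrite -{2}(op_refl_invol p cc); apply: rle_up => //.
by rewrite !e_refl // swpL swpR.
Qed.

Lemma pmin_refl c p : adjacent c -> pmin c (op (refl c (c + 1)) p) = pmin c p.
Proof.
move=> cc; rewrite /pmin !e_refl // swpL swpR //.
case: (ltgtP (e p (c + 1)) (e p c)) => [||h] //; first by rewrite op_refl_invol.
by rewrite op_id.
Qed.

Lemma pmax_refl c p : adjacent c -> pmax c (op (refl c (c + 1)) p) = pmax c p.
Proof.
move=> cc; rewrite /pmax !e_refl // swpL swpR //.
case: (ltgtP (e p (c + 1)) (e p c)) => [||h] //; first by rewrite op_refl_invol.
by rewrite op_refl_invol // op_id.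
Qed.

(** If a step is the simple reflection itself, both minima agree. Otherwise the mirror images are
    also related by an upward step, and every combination of choices can be linked through one of
    the two steps. *)
Lemma pmin_homo c p r : adjacent c -> rle p r -> rle (pmin c p) (pmin c r).
Proof.
move=> cc; elim=> {p r} [p r pr|p|p q r _ pq _ qr]; last 1 first.
- exact: rt_trans pq qr.
- have [->|sprs] := rstep_adjacent cc pr; first by rewrite pmin_refl //; exact: rt_refl.
  rewrite /pmin; case: ifP => hp; case: ifP => hr; try exact: rt_step.
  + by apply: rt_trans (rt_step _ _ _ _ sprs); exact: rle_up.
  + by apply: rt_trans (rt_step _ _ _ _ pr); apply: rle_down => //; lia.
- exact: rt_refl.
Qed.

Lemma pmax_homo c p r : adjacent c -> rle p r -> rle (pmax c p) (pmax c r).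
Proof.
move=> cc; elim=> {p r} [p r pr|p|p q r _ pq _ qr]; last 1 first.
- exact: rt_trans pq qr.
- have [->|sprs] := rstep_adjacent cc pr; first by rewrite pmax_refl //; exact: rt_refl.
  rewrite /pmax; case: ifP => hp; case: ifP => hr; try exact: rt_step.
  + by apply: (rt_trans _ _ _ _ _ (rt_step _ _ _ _ sprs)); apply: rle_down => //; lia.
  + by apply: (rt_trans _ _ _ _ _ (rt_step _ _ _ _ pr)); exact: rle_up.
- exact: rt_refl.
Qed.

End ReflectionOrder.

(** * The Bruhat order *)

Lemma refl_sym a b : res a != res b -> refl b a = refl a b.
Proof.
move=> ab; apply: eq_affPerm => c.
rewrite !afun_refl // 1?eq_sym // /swp; case: (eqVneq (res c) (res a)) => [ca|//].
by rewrite ca (negbTE ab).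
Qed.

(** Since [refl] is unchanged by a common shift by n, one period of c suffices; its last integer
    gives s_0. [adjacent] fails only for n = 1, where there is no simple reflection. *)
Lemma simple_reflectionP (s : affPerm n) :
  simple_reflection s <-> exists2 c, adjacent c & s = refl c (c + 1).
Proof.
have quo0 c : 0 <= c < n -> quo c = 0 by move=> h; apply: divz_small; lia.
split=> [[[i [j [ji ->]]]|[i [j [i0 jn ij ->]]]]|[c cc ->]].
- exists i%:Z; rewrite /adjacent /refl; have -> : i%:Z + 1 = j by lia.
    by rewrite !res_ord -val_eqE /= ji; lia.
  by rewrite !res_ord !quo_ord subrr scale0r.
- exists j%:Z; rewrite /adjacent /refl;
    have -> : j%:Z + 1 = i%:Z + 1 * n%:Z by lia.
    by rewrite res_shift !res_ord -val_eqE /=; lia.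
  rewrite res_shift quo_shift !res_ord !quo_ord tpermC; congr AffPerm.
  by have -> : 0 - (0 + 1) = -1 :> int by []; rewrite scaleN1r opprB.
have [r [q cE]] : exists (r : 'I_n) q, c = r%:Z + q * n.
  by exists (res c), (quo c); exact: divz_res.
rewrite {c}cE /adjacent addrAC !res_shift in cc *; rewrite refl_shift.
move: cc => rr; have [rn|nr] := ltnP r.+1 n.
  left; exists r, (Ordinal rn); split=> //.
  rewrite /refl (_ : r%:Z + 1 = Ordinal rn); last by rewrite /=; lia.
  by rewrite !res_ord !quo_ord subrr scale0r.
have rn : r.+1 = n by apply/eqP; rewrite eqn_leq ltn_ord.
have r1 : r%:Z + 1 = (Ordinal n_gt0)%:Z + 1 * n%:Z by rewrite /=; lia.
right; exists (Ordinal n_gt0), r; split=> //.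
  move: rr; rewrite r1 res_shift !res_ord -val_eqE /=; lia.
rewrite r1 /refl res_shift quo_shift !res_ord !quo_ord tpermC; congr AffPerm.
by have -> : 0 - (0 + 1) = -1 :> int by []; rewrite scaleN1r opprB.
Qed.

Lemma expressible1 : expressible (1%g : affPerm n) 0.
Proof. by exists [::]; split=> //; rewrite big_nil. Qed.

Lemma expressibleM x y k l :
  expressible x k -> expressible y l -> expressible (x * y)%g (k + l).
Proof.
move=> [s [sk ss ->]] [t [tl tt ->]]; exists (s ++ t).
rewrite size_cat sk tl big_cat; split=> // r.
by rewrite mem_cat => /orP[/ss|/tt].
Qed.

Lemma expressible_adjacent c : adjacent c -> expressible (refl c (c + 1)) 1.
Proof.
move=> cc; exists [:: refl c (c + 1)]; split=> //; last by rewrite big_seq1.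
by move=> r; rewrite inE => /eqP ->; apply/simple_reflectionP; exists c.
Qed.

Lemma Waff1 : Waff (1%g : affPerm n).
Proof. by exists 0%N; exact: expressible1. Qed.

Lemma WaffM x y : Waff x -> Waff y -> Waff (x * y)%g.
Proof. by move=> [k xk] [l yl]; exists (k + l)%N; exact: expressibleM. Qed.

(* The strong exchange condition: in a word for w, the wall of refl a b is
   crossed at some letter, which can be deleted. *)
Lemma strong_exchange w k a b : expressible w k -> a < b -> res a != res b ->
  afun w b < afun w a -> exists2 l, (l < k)%N & expressible (refl a b * w)%g l.
Proof.
move=> [s [<- ss ->]] ab rab {w k}; elim/last_ind: s ss => [|s r IHs] ss.
  by rewrite big_nil !afun1; lia.
rewrite -cats1 big_cat big_seq1 /=; set w := (\prod_(i <- s) i)%g => inv.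
have ss' i : i \in s -> simple_reflection i.
  by move=> si; apply: ss; rewrite mem_rcons inE si orbT.
have /simple_reflectionP[c cc rE] : simple_reflection r.
  by apply: ss; rewrite mem_rcons inE eqxx.
have r1 : expressible r 1 by rewrite rE; exact: expressible_adjacent.
have [lt_w|ge_w] := ltP (afun w b) (afun w a).
  have [l ls el] := IHs ss' lt_w.
  exists (l + 1)%N; first by rewrite size_cat /= ltn_add2r.
  by rewrite mulgA; exact: expressibleM.
have {ge_w} lt_w : afun w a < afun w b.
  rewrite lt_neqAle ge_w andbT; apply: contra rab => /eqP /afun_inj ->.
  exact: eqxx.
have rw : res (afun w a) != res (afun w b) by rewrite eq_res_afun.
have [lt_s|eq_r] := swp_adjacent cc lt_w rw.
  by move: inv; rewrite !afunM rE !afun_refl //; lia.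
exists (size s); first by rewrite size_cat /= addn1.
have -> : (refl a b * (w * r) = w)%g.
  rewrite rE -eq_r refl_afun // !mulgA -(mulgA (refl a b) w) mulgV mulg1.
  by rewrite refl_invol // mul1g.
by exists s.
Qed.

Lemma Waff_length w : Waff w -> exists k, has_length w k.
Proof.
move=> [k wk]; have ex : exists k, `[< expressible w k >] by exists k; apply/asboolP.
by case: (ex_minnP ex) => m /asboolP wm le_m; exists m; split=> // l /asboolP /le_m.
Qed.

(** Conjugating by the simple reflection at a shortens the distance b - a until it is 1. *)
Lemma reflection_refl a b : a < b -> res a != res b ->
  reflection (refl a b) /\ Waff (refl a b).
Proof.
have [m] := ubnP `|b - a|%N; elim: m => // m IHm in a b *.
rewrite ltnS => hm ab rab; have [ba|ba] := eqVneq b (a + 1).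
  rewrite ba in rab *; split; last by exists 1%N; exact: expressible_adjacent.
  exists 1%g, (refl a (a + 1)); split; first exact: Waff1.
    by apply/simple_reflectionP; exists a.
  by rewrite mul1g invg1 mulg1.
(* Otherwise all integers would be congruent, contrary to [rab]. *)
have aa : adjacent a.
  rewrite /adjacent; apply: contra rab => /eqP e.
  have [q qE] : exists q : nat, b = a + q%:Z by exists `|b - a|%N; lia.
  rewrite {b ab ba hm}qE; elim: q => [|q /eqP IHq]; first by rewrite addr0.
  rewrite -addn1 PoszD addrA e eq_res_add; exact/eqP.
set s := refl a (a + 1); have sV := reflV aa.
have [lt_s m_s] : swp a (a + 1) a < swp a (a + 1) b /\
    (`|swp a (a + 1) b - swp a (a + 1) a| < m)%N.
  rewrite swpL /swp eq_sym (negbTE rab).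
  case: ifP => [rb|_]; last by move/eqP: ba; lia.
  (* Here the pair becomes a + 1, b - 1. For b = a + 2 the two would coincide, but then a and a + 1
     would be congruent. *)
  have ba2 : b != a + 1 + 1.
    by apply: contra aa => /eqP ba2; rewrite -(eq_res_add _ _ 1) -ba2 eq_sym.
  by move/eqP: ba; move/eqP: ba2; lia.
have r_s : res (swp a (a + 1) a) != res (swp a (a + 1) b).
  by rewrite -!afun_refl // eq_res_afun.
have [] := IHm _ _ m_s lt_s r_s.
rewrite -!afun_refl // refl_afun // -/s sV => -[w [r [Ww sr wE]]] Wr.
have Ws : Waff s by exists 1%N; exact: expressible_adjacent.
have ss : (s * s = 1)%g by exact: refl_invol.
have abE : refl a b = (s * (s * refl a b * s) * s)%g.
  by rewrite !mulgA ss mul1g -mulgA ss mulg1.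
split; last by rewrite abE; apply: WaffM => //; apply: WaffM.
exists (s * w)%g, r; split=> //; first exact: WaffM.
by rewrite abE wE invMg sV !mulgA.
Qed.

Lemma reflection_is_refl t : reflection t ->
  exists a b, [/\ a < b, res a != res b & t = refl a b].
Proof.
move=> [w [s [Ww /simple_reflectionP[c cc ->] ->]]].
have := @refl_afun (w^-1)%g _ _ cc; rewrite invgK => <-; set x := (w^-1)%g.
have rr : res (afun x c) != res (afun x (c + 1)) by rewrite eq_res_afun.
have [lt|ge] := ltP (afun x c) (afun x (c + 1)).
  by exists (afun x c), (afun x (c + 1)).
exists (afun x (c + 1)), (afun x c); split=> //.
- by rewrite lt_neqAle ge andbT; apply: contra rr => /eqP ->.
- by rewrite eq_sym.
by apply: refl_sym; rewrite eq_sym.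
Qed.

(** A form of the Bruhat order free of lengths and of the factor in [Omega]; it agrees with [bruhat]
    by [aleq_bruhat] and [bruhat_aleq]. The minus sign makes the creation of an inversion of [afun]
    an upward step. *)
Definition aleq := rle (fun x y => x * y)%g (fun x c => - afun x c).

Lemma aleq_step x a b : a < b -> res a != res b -> afun x a < afun x b ->
  aleq x (refl a b * x)%g.
Proof.
by move=> ab rab xab; apply: rt_step; exists a, b; split=> //; rewrite ltrN2.
Qed.

(** Conjugation turns the right factor into a left one. If that removed an inversion of u, strong
    exchange would write w with fewer letters than the length of u. *)
Lemma bruhat_step_refl u w : bruhat_step u w ->
  exists a b, [/\ a < b, res a != res b, afun u a < afun u b & w = (refl a b * u)%g].
Proof.
move=> [t [k [l [/reflection_is_refl[a [b [ab rab ->]]] wE [uk _] [_ min_l] kl]]]].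
have := refl_afun u^-1%g rab; rewrite invgK; set x := (u^-1)%g => tE.
have [c [d [cd rcd wE']]] :
    exists c d, [/\ c < d, res c != res d & w = (refl c d * u)%g].
  have rr : res (afun x a) != res (afun x b) by rewrite eq_res_afun.
  have wE' : w = (refl (afun x a) (afun x b) * u)%g by rewrite tE -mulgA mulVg mulg1.
  have [lt|ge] := ltP (afun x a) (afun x b); first by exists (afun x a), (afun x b).
  exists (afun x b), (afun x a); split.
  - by rewrite lt_neqAle ge andbT; apply: contra rr => /eqP ->.
  - by rewrite eq_sym.
  by rewrite refl_sym.
exists c, d; split=> //; rewrite ltNge le_eqVlt; apply/negP => /predU1P[|inv].
  by move/afun_inj => e; rewrite e eqxx in rcd.
have [m mk] := strong_exchange uk cd rcd inv.
by rewrite -wE' => /min_l; rewrite leqNgt (ltn_trans mk).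
Qed.

(** The product inverts the pair, so strong exchange applied to it shows that u is shorter. *)
Lemma refl_bruhat_step u a b : Waff u -> a < b -> res a != res b ->
  afun u a < afun u b -> bruhat_step u (refl a b * u)%g.
Proof.
move=> Wu ab rab uab; have [tt Wt] := reflection_refl ab rab.
have [k uk] := Waff_length Wu.
have [l ul] := Waff_length (WaffM Wt Wu).
exists (u^-1 * refl a b * u)%g, k, l; split=> //.
- have ruv : res (afun u a) != res (afun u b) by rewrite eq_res_afun.
  by rewrite -refl_afun //; have [] := reflection_refl uab ruv.
- by rewrite !mulgA mulgV mul1g.
have [|m ml um] := strong_exchange ul.1 ab rab.
  by rewrite !afunM !afun_refl // swpL swpR.
apply: leq_ltn_trans ml; apply: uk.2.
by rewrite mulgA refl_invol // mul1g in um.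
Qed.

Lemma Omega_afun_lt x a b : Omega x -> a < b -> afun x a < afun x b.
Proof.
move=> Ox ab; rewrite lt_neqAle; apply/andP; split.
  by apply/eqP => /afun_inj e; rewrite e ltxx in ab.
(* The base vertex of index [afun x a] drops exactly there, so antitonicity of its image, again a
   base vertex, bounds [afun x b] from below. *)
set i := afun x a; have [i' e] : exists i', omega n i' = act x (omega n i).
  have : [set act x v | v in range (@omega n)]%classic (act x (omega n i)).
    by exists (omega n i) => //; exists i.
  by rewrite Ox => -[i' _ <-]; exists i'.
have := ext_omega_ge i' (ltW ab).
rewrite e !ext_act !ext_omega lerN2 subrr div0z divz_ge0; last by lia.
by rewrite subr_ge0.
Qed.

(** The function [afun x c - c] is non-decreasing and n-periodic, hence constant: x shifts the
    indices of the base vertices. *)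
Lemma afun_lt_Omega x : (forall c, afun x c < afun x (c + 1)) -> Omega x.
Proof.
move=> x_lt; have mono c (q : nat) : afun x c - c <= afun x (c + q%:Z) - (c + q%:Z).
  elim: q => [|q IHq]; first by rewrite addr0.
  have -> : c + q.+1%:Z = c + q%:Z + 1 by lia.
  by have := x_lt (c + q%:Z); lia.
have homo c d : c <= d -> afun x c - c <= afun x d - d.
  move=> cd; have := mono c `|d - c|%N; rewrite gez0_abs ?subr_ge0 //.
  by rewrite (addrC c) subrK.
set m := afun x 0; have xE c : afun x c = c + m.
  have h1 : 0 + (- `|c|%:Z) * n <= c by nia.
  have h2 : c <= 0 + `|c|%:Z * n by nia.
  have := homo _ _ h1; have := homo _ _ h2; rewrite !(afun_shift x 0) -/m; lia.
have omegaE i : act x (omega n i) = omega n (i - m).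
  apply: ext_inj => c; rewrite ext_act !ext_omega xE.
  by have -> : c + m - i = c - (i - m) by ring.
apply/seteqP; split=> [_ [_ [i _ <-] <-]|_ [i _ <-]].
  by exists (i - m).
by exists (omega n (i + m)); [exists (i + m)|rewrite omegaE addrK].
Qed.

(** The induction measure is the sum of the squares of [afun x c - c] over one period, which
    decreases when a descent is swapped. *)
Lemma descent_ind (P : affPerm n -> Prop) :
    (forall x, Omega x -> P x) ->
    (forall x c, adjacent c -> afun x (c + 1) < afun x c ->
       P (refl c (c + 1) * x)%g -> P x) ->
  forall x, P x.
Proof.
move=> P_Omega P_descent x.
pose D x c : int := (afun x c - c) ^+ 2.
have D_res y c : D y (res c)%:Z = D y c.
  rewrite /D [in RHS](divz_res c) afun_shift; congr (_ ^+ 2); ring.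
pose M y := \sum_(r < n) D y r%:Z.
have M_ge0 y : 0 <= M y by apply: sumr_ge0 => r _; exact: sqr_ge0.
have [m] := ubnP `|M x|%N; elim: m => // m IHm in x *; rewrite ltnS => hm.
have [xl|] := pselect (forall c, afun x c < afun x (c + 1)).
  exact: P_Omega (afun_lt_Omega xl).
move=> /existsNP[c /negP]; rewrite -leNgt le_eqVlt => /predU1P[/afun_inj|inv].
  by lia.
have cc : adjacent c.
  apply/negP => /eq_resP[q cE]; have q0 : q < 0 by nia.
  by move: inv; rewrite {2}cE afun_shift; nia.
apply: (P_descent x c) => //; apply: IHm; apply: leq_trans hm.
suff : M (refl c (c + 1) * x)%g < M x.
  by have := M_ge0 x; have := M_ge0 (refl c (c + 1) * x)%g; lia.
have rc : res (c + 1) != res c by rewrite eq_sym.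
rewrite /M (bigD1 (res c)) // (bigD1 (res (c + 1))) //=.
rewrite [X in _ < X](bigD1 (res c)) // [X in _ < _ + X](bigD1 (res (c + 1))) //=.
rewrite [X in _ + (_ + X) < _](_ : _ = \sum_(i < n | (i != res c) && (i != res (c + 1))) D x i%:Z).
  rewrite !addrA ltrD2r !D_res /D !afunM !afun_refl // swpL swpR //; nia.
apply: eq_bigr => r /andP[r1 r2].
by rewrite /D afunM afun_refl // /swp !res_ord (negbTE r1) (negbTE r2).
Qed.

(** Removing descents brings y down to some [tau] in [Omega]. Steps multiply by reflections on the
    left, so they keep this [tau]; since [afun tau] is increasing, they are upward steps between the
    factors in [Waff]. *)
Lemma aleq_bruhat x y : aleq x y -> bruhat x y.
Proof.
have [w [tau [Ww Ot ->]]] : exists w tau, [/\ Waff w, Omega tau & y = (w * tau)%g].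
  elim/descent_ind: y => [tau Ot|y c cc _ [w [tau [Ww Ot yE]]]].
    by exists 1%g, tau; split; rewrite ?mul1g //; exact: Waff1.
  exists (refl c (c + 1) * w)%g, tau; split=> //.
    by apply: WaffM => //; exists 1%N; exact: expressible_adjacent.
  by rewrite -mulgA -yE mulgA refl_invol // mul1g.
move yE : (w * tau)%g => z xz {y}.
suff [w' [Ww' xE ww']] : exists w', [/\ Waff w', x = (w' * tau)%g & bruhat_aff w' w].
  by exists w', w, tau.
elim: xz w Ww yE => {x z} [x y [a [b [ab rab xab ->]]]|x|x y z _ IHxy _ IHyz] w Ww.
- rewrite ltrN2 in xab => wE.
  have Wr := (reflection_refl ab rab).2.
  have xE : x = ((refl a b * w) * tau)%g.
    by rewrite -mulgA wE mulgA refl_invol // mul1g.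
  exists (refl a b * w)%g; split=> //; first exact: WaffM.
  have wE' : w = (refl a b * (refl a b * w))%g by rewrite mulgA refl_invol // mul1g.
  rewrite {2}wE'; apply: rt_step; apply: refl_bruhat_step => //; first exact: WaffM.
  move: xab; rewrite xE afunM (afunM _ tau).
  case: (ltgtP (afun (refl a b * w)%g a) (afun (refl a b * w)%g b)) => // [lt|->].
    by have := Omega_afun_lt Ot lt; lia.
  by rewrite ltxx.
- by move=> <-; exists w; split=> //; exact: rt_refl.
move=> zE; have [w1 [W1 yE ww1]] := IHyz w Ww zE.
have [w2 [W2 xE ww2]] := IHxy w1 W1 (esym yE).
by exists w2; split=> //; exact: rt_trans ww1.
Qed.

Lemma bruhat_aleq x y : bruhat x y -> aleq x y.
Proof.
move=> [w [w' [tau [[_ _ Ot] [-> ->]]]]].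
elim=> {x y w w'} [u w /bruhat_step_refl[a [b [ab rab uab ->]]]|w|w1 w2 w3 _ h _].
- by rewrite -mulgA; apply: aleq_step => //; rewrite !afunM; exact: Omega_afun_lt.
- exact: rt_refl.
exact: rt_trans.
Qed.

(** * Lifting faces *)

Definition vleq := rle (@act n) ext.

Lemma act_refl_id a b v : res a != res b -> ext v a = ext v b ->
  act (refl a b) v = v.
Proof.
move=> ab e; apply: ext_inj => c; rewrite ext_act afun_refl // /swp.
case: eq_resP => [[q ->]|_].
  by rewrite addrAC (addrC a) subrK !ext_shift e.
case: eq_resP => [[q ->]|//].
by rewrite addrAC (addrC b) subrK !ext_shift e.
Qed.

Lemma mul_refl_id a b x : res a != res b -> - afun x a = - afun x b ->
  (refl a b * x)%g = x.
Proof. by move=> ab /oppr_inj /afun_inj e; rewrite e eqxx in ab. Qed.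

(** Each upward step ends in a vector with a strict ascent, so an antitone one is minimal. *)
Lemma vleq_antidominant v v' : (forall a b, a < b -> ext v' b <= ext v' a) ->
  vleq v v' -> v = v'.
Proof.
move=> anti vv'; elim: vv' anti => {v v'} [v v' [a [b [ab rab vab ->]]]|//|] anti.
  have := anti a b ab; rewrite !ext_act !afun_refl // swpL swpR //; lia.
by move=> v2 v3 _ IH1 _ IH2 anti3; have e := IH2 anti3; rewrite -e in anti3 *; exact: IH1.
Qed.

(** No affine reflection hyperplane strictly separates two members, as for the vertices of one
    alcove. *)
Definition noncrossing (J : Type) (v : J -> 'rV[int]_n) := forall a b,
  (forall i, ext (v i) a <= ext (v i) b) \/ (forall i, ext (v i) b <= ext (v i) a).

(* Deodhar's argument: a simple reflection descending y is applied to those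
   of y and the family which lie on its far side. *)
Lemma lift_family (J : Type) (idx : J -> int) y (v : J -> 'rV[int]_n) :
  noncrossing v -> (forall i, vleq (v i) (act y (omega n (idx i)))) ->
  exists2 x, aleq x y & forall i, v i = act x (omega n (idx i)).
Proof.
elim/descent_ind: y v => [y Oy|y c cc inv IHy] v ncv vy.
  exists y; first exact: rt_refl.
  move=> i; apply: vleq_antidominant (vy i) => a b ab.
  by rewrite !ext_act; apply: ext_omega_ge; apply: ltW; exact: Omega_afun_lt.
set s := refl c (c + 1) in IHy *.
have le_sy : aleq (s * y)%g y.
  have := @aleq_step (s * y)%g c (c + 1); rewrite mulgA refl_invol // mul1g.
  by apply=> //; [lia|rewrite !afunM !afun_refl // swpL swpR].
have min_y i : pmin (@act n) ext c (act y (omega n (idx i))) =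
    act (s * y)%g (omega n (idx i)).
  rewrite actM /pmin; case: ifP => // h; rewrite act_refl_id //.
  apply/eqP; rewrite eq_le h andbT !ext_act; apply: ext_omega_ge; exact: ltW.
have min_v i : vleq (pmin (@act n) ext c (v i)) (act (s * y)%g (omega n (idx i))).
  rewrite -min_y; apply: pmin_homo => //; first exact: actM.
  - exact: act1.
  - exact: act_refl_id.
  - exact: ext_act.
  exact: vy.
(* Non-crossing makes the choice in [pmin] uniform: the family is either kept or reflected as a
   whole, members on the wall being fixed. *)
have [vc|vc] := ncv c (c + 1); last first.
  have sv i : vleq (v i) (act (s * y)%g (omega n (idx i))).
    by have := min_v i; rewrite /pmin vc.
  have [x xy xE] := IHy v ncv sv.
  by exists x => //; exact: rt_trans le_sy.
have ncsv : noncrossing (act s \o v).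
  by move=> a b; have [h|h] := ncv (afun s a) (afun s b); [left|right] => i;
    rewrite /= !ext_act.
have sv i : vleq ((act s \o v) i) (act (s * y)%g (omega n (idx i))).
  have := min_v i; rewrite /pmin; case: ifP => // h.
  by rewrite /= act_refl_id //; apply/eqP; rewrite eq_le vc h.
have [x xy xE] := IHy _ ncsv sv.
exists (s * x)%g; last first.
  by move=> i; rewrite actM -xE /= -actM refl_invol // act1.
(* The lift of the original family is s x. If s x is above x, it is the [pmax] of x, so monotonicity
   puts it below y; otherwise it is below x already. *)
have max_y : pmax (fun x y => x * y)%g (fun x c => - afun x c) c (s * y)%g = y.
  rewrite /pmax !afunM !afun_refl // swpL swpR // lerN2 (ltW inv).
  by rewrite mulgA refl_invol // mul1g.
have : aleq (pmax (fun x y => x * y)%g (fun x c => - afun x c) c x) y.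
  rewrite -max_y; apply: pmax_homo => //; first by move=> z1 z2 z3; rewrite mulgA.
  - exact: mul1g.
  - exact: mul_refl_id.
  by move=> z p d; rewrite afunM.
rewrite /pmax lerN2; case: ifP => // /negbT; rewrite -ltNge => h _.
apply: rt_trans le_sy; apply: rt_trans xy.
have := @aleq_step (s * x)%g c (c + 1); rewrite mulgA refl_invol // mul1g.
by apply=> //; [lia|rewrite !afunM !afun_refl // swpL swpR].
Qed.

Lemma ext_sub v v' c : (v - v') 0 (res c) = ext v c - ext v' c.
Proof. by rewrite /ext !mxE; ring. Qed.

End Extension.

Local Open Scope classical_set_scope.

(** * The permutation polytope *)

Section Polytope.
Variables (R : realType) (n : nat).
Implicit Types (M : set 'rV[R]_n) (L : 'rV[R]_n) (mu : 'rV[int]_n).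

Lemma convex_setE M : @convex_set R 'rV[R]_n M <->
  forall L L' (t : R), 0 <= t -> t <= 1 -> M L -> M L' -> M (t *: L + (1 - t) *: L').
Proof.
split=> [cM L L' t t0 t1 ML ML'|cM L L' t /set_mem ML /set_mem ML'].
  pose k := Itv01 t0 t1.
  by have := cM L L' k (mem_set ML) (mem_set ML') => /set_mem.
by apply/mem_set; apply: cM => //.
Qed.

Lemma convex_orbit_polytope mu : @convex_set R 'rV[R]_n (orbit_polytope R mu).
Proof.
apply/convex_setE => L L' t t0 t1 ML ML' M [cM oM].
have cM' := (convex_setE M).1 cM.
by apply: cM' => //; [apply: ML|apply: ML'].
Qed.

Lemma orbit_polytope_vertex mu (s : 'S_n) :
  orbit_polytope R mu (map_mx intr (col_perm s mu)).
Proof. by move=> M [_ oM]; apply: oM; exists s. Qed.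

Lemma orbit_polytope_perm mu (s : 'S_n) L :
  orbit_polytope R mu L -> orbit_polytope R mu (col_perm s L).
Proof.
move=> ML M [cM oM].
apply: (ML [set L | M (col_perm s L)]); split=> [|_ [s' _ <-]] /=.
  apply/convex_setE => L1 L2 t t0 t1 /= M1 M2.
  by rewrite linearD !linearZ; apply: (convex_setE M).1.
by rewrite -map_col_perm -col_permM; apply: oM; exists (s * s')%g.
Qed.

(* The new point lies on the segment between L and its image under the
   transposition of A and B. *)
Lemma orbit_polytope_transfer mu L (A B : 'I_n) (d : R) :
  A != B -> 0 <= d -> d <= L 0 B - L 0 A -> orbit_polytope R mu L ->
  orbit_polytope R mu (L + d *: (delta_mx 0 A - delta_mx 0 B)).
Proof.
move=> AB d0 dL ML; have [dd|dd] := eqVneq (L 0 B - L 0 A) 0.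
  have -> : d = 0 by apply/eqP; rewrite eq_le d0 -dd dL.
  by rewrite scale0r addr0.
have D0 : 0 < L 0 B - L 0 A by rewrite lt_neqAle eq_sym dd (le_trans d0).
set D := L 0 B - L 0 A in dd dL D0.
have := (convex_setE _).1 (@convex_orbit_polytope mu) _ _ (d / D) _ _
  (orbit_polytope_perm (tperm A B) ML) ML.
rewrite divr_ge0 ?(ltW D0) // ler_pdivrMr // mul1r => /(_ isT dL).
congr (orbit_polytope R mu _); apply/rowP => j; rewrite !mxE eqxx /=.
have DE : L 0 B = L 0 A + D by rewrite /D; ring.
case: tpermP => [->|->|/eqP/negbTE -> /eqP/negbTE ->].
- by rewrite eqxx (negbTE AB) DE ?mulr1n ?mulr0n; field.
- by rewrite eqxx [B == A]eq_sym (negbTE AB) DE ?mulr1n ?mulr0n; field.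
by rewrite /=; ring.
Qed.

Lemma orbit_polytope_le mu (C : 'I_n -> R) (bound : R) L :
  (forall s : 'S_n, \sum_j C j * (mu 0 (s j))%:~R <= bound) ->
  orbit_polytope R mu L -> \sum_j C j * L 0 j <= bound.
Proof.
move=> le_bound ML.
apply: (ML [set L | \sum_j C j * L 0 j <= bound]); split=> [|_ [s _ <-]] /=.
  apply/convex_setE => L1 L2 t t0 t1 /= M1 M2.
  have -> : \sum_j C j * (t *: L1 + (1 - t) *: L2) 0 j =
      t * (\sum_j C j * L1 0 j) + (1 - t) * (\sum_j C j * L2 0 j).
    by rewrite !mulr_sumr -big_split; apply: eq_bigr => j _; rewrite !mxE /=; ring.
  by nra.
by under eq_bigr do rewrite !mxE.
Qed.

End Polytope.

(** * Vertices in an acute cone *)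

Section PartialSums.
Variables (n : nat).
Implicit Types (F L m : 'I_n -> int).

Definition psum F (k : nat) : int := \sum_(j < n | (j < k)%N) F j.

Lemma psum0 F : psum F 0 = 0.
Proof. by rewrite /psum big_pred0. Qed.

Lemma psumS F (j : 'I_n) : psum F j.+1 = psum F j + F j.
Proof.
rewrite /psum (bigD1 j) //= addrC; congr (_ + _).
apply: eq_bigl => i; rewrite ltnS -val_eqE /=; lia.
Qed.

Lemma eq_psum F L : (forall k, psum F k = psum L k) -> F =1 L.
Proof. by move=> e j; have := e j.+1; rewrite !psumS e => /addrI. Qed.

(* With l .. r a maximal range of strict inequalities, L l < m l and m r < L r;
   monotonicity of m then forces the last two properties. *)
Lemma raising_pair L m :
  (forall j k : 'I_n, (j <= k)%N -> m k <= m j) ->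
  (forall j k : 'I_n, (j < k)%N -> L k <= L j + 1) ->
  (forall k, psum L k <= psum m k) -> psum L n = psum m n ->
  (exists k, psum L k <> psum m k) ->
  exists l r : 'I_n,
   [/\ (l < r)%N,
       forall k, (l < k <= r)%N -> psum L k < psum m k,
       forall j : 'I_n, (j < l)%N -> L l + 1 <= L j &
       forall j : 'I_n, (r < j)%N -> L j + 1 <= L r].
Proof.
move=> m_dom L_dom le_Lm eq_n [k0 neq0].
pose D k := psum m k - psum L k.
have D_ge0 k : 0 <= D k by rewrite subr_ge0.
have DS (j : 'I_n) : D j.+1 = D j + (m j - L j) by rewrite /D !psumS; ring.
have D_n k : (n <= k)%N -> D k = 0.
  move=> nk; apply/eqP; rewrite subr_eq0 eq_sym.
  have pE F : psum F k = psum F n.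
    by apply: eq_bigl => i; rewrite ltn_ord (leq_trans (ltn_ord i)).
  by rewrite !pE eq_n.
have D_k0 : D k0 != 0 by rewrite subr_eq0 eq_sym; apply/eqP.
have k0n : (k0 < n)%N by rewrite ltnNge; apply: contra D_k0 => /D_n ->.
have [l [l0 Dl l_max]] : exists l, [/\ (l < k0)%N, D l = 0 &
    forall k, (l < k < k0)%N -> D k != 0].
  have exl : exists l, (l <= k0)%N && (D l == 0).
    by exists 0%N; rewrite /D !psum0.
  have ub l : (l <= k0)%N && (D l == 0) -> (l <= k0)%N by case/andP.
  case: (ex_maxnP exl ub) => l /andP[lk /eqP Dl] l_max; exists l; split=> //.
    by rewrite ltn_neqAle lk andbT; apply: contra D_k0 => /eqP <-; apply/eqP.
  move=> k /andP[lk' kk]; apply/negP => Dk.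
  by have := l_max k; rewrite Dk (ltnW kk) leqNgt lk' => /(_ isT).
have [r1 [r0 Dr r_min]] : exists r, [/\ (k0 < r)%N, D r = 0 &
    forall k, (k0 < k < r)%N -> D k != 0].
  have exr : exists r, (k0 <= r)%N && (D r == 0).
    by exists n; rewrite (ltnW k0n) D_n.
  case: (ex_minnP exr) => r /andP[kr /eqP Dr'] r_min; exists r; split=> //.
    rewrite ltn_neqAle kr andbT; apply: contra D_k0 => /eqP ->; exact/eqP.
  move=> k /andP[kk rk]; apply/negP => Dk.
  by have := r_min k; rewrite Dk (ltnW kk) leqNgt rk => /(_ isT).
have r1n : (r1 <= n)%N.
  rewrite leqNgt; apply/negP => nr; have := r_min n.
  by rewrite k0n nr D_n // => /(_ isT); rewrite eqxx.
have D_mid k : (l < k < r1)%N -> 0 < D k.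
  move=> /andP[lk kr]; rewrite lt_neqAle eq_sym D_ge0 andbT.
  have [kk|kk|->//] := ltngtP k k0; first by apply: l_max; rewrite lk.
  by apply: r_min; rewrite kk.
(* [psum] up to k omits the index k, so the block between the zeros l and r1 of [D] has first index
   l and last index r1 - 1. *)
case: r1 => [|r] in r0 Dr r_min r1n D_mid *; first by [].
have ln : (l < n)%N by lia.
pose l' := Ordinal ln; pose r' := Ordinal r1n.
have lr : (l < r)%N by lia.
have Ll : L l' < m l'.
  by have := DS l'; have := D_mid l.+1; rewrite /= ltnSn /= Dl; lia.
have Lr : m r' < L r'.
  by have := DS r'; have := D_mid r; rewrite /= lr ltnSn /= Dr; lia.
exists l', r'; split=> // [k lkr|j jl|j rj].
- by rewrite -subr_gt0; apply: D_mid; rewrite /= in lkr; lia.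
- rewrite leNgt; apply/negP => Lj.
  (* If L j <= L l, then L j < m j, and L k <= L j + 1 <= m l <= m k for j < k < l. So [D], positive
     at j + 1, could not return to 0 at l. *)
  have gt0 k : (j < k <= l)%N -> 0 < D k.
    elim: k => // k IHk jkl; have kn : (k < n)%N by lia.
    rewrite (DS (Ordinal kn)) /=.
    have m_l : m l' <= m (Ordinal kn) by apply: m_dom => /=; lia.
    have [jk|jk] := eqVneq (j : nat) k.
      have -> : Ordinal kn = j by apply/val_inj.
      have m_j : m l' <= m j by apply: m_dom => /=; lia.
      by rewrite -jk; have := D_ge0 j; lia.
    have jk' : (j < k)%N by lia.
    have := IHk; have := L_dom j (Ordinal kn) jk'.
    by rewrite jk' /=; move=> h1 /(_ ltac:(lia)); lia.
  by have := gt0 l; rewrite jl leqnn Dl ltxx => /(_ isT).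
rewrite leNgt; apply/negP => Lj.
have le0 k : (r < k <= j)%N -> D k <= 0.
  elim: k => // k IHk rkj; have kn : (k < n)%N by have := ltn_ord j; lia.
  have [->|rk] := eqVneq k r; first by rewrite Dr.
  rewrite (DS (Ordinal kn)) /=.
  have m_r : m (Ordinal kn) <= m r' by apply: m_dom => /=; lia.
  have kj : (k < j)%N by lia.
  have := IHk; have := L_dom (Ordinal kn) j kj.
  by move=> h1 /(_ ltac:(lia)); lia.
have m_r : m j <= m r' by apply: m_dom; apply: ltnW.
have := D_ge0 j.+1; have := le0 j; rewrite DS rj leqnn => /(_ isT); lia.
Qed.

End PartialSums.

(** After subtracting the threshold m k from all entries, the sum of the first k entries of m is the
    sum of all positive parts, which no permutation changes and which bounds every partial sum. *)
Lemma psum_perm (n : nat) (m : 'I_n -> int) (s : 'S_n) (k : nat) :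
  (forall i j : 'I_n, (i <= j)%N -> m j <= m i) ->
  psum (m \o s) k <= psum m k.
Proof.
move=> m_dom; have [nk|kn] := leqP n k.
  rewrite /psum; under eq_bigl do rewrite (leq_trans (ltn_ord _) nk).
  under [X in _ <= X]eq_bigl do rewrite (leq_trans (ltn_ord _) nk).
  by rewrite [X in _ <= X](reindex_inj (@perm_inj _ s)).
pose t := m (Ordinal kn); pose pos (x : int) := Num.max (x - t) 0.
have split_t (F : 'I_n -> int) :
    psum F k = psum (fun j => F j - t) k + psum (fun _ : 'I_n => t) k.
  by rewrite /psum -big_split; apply: eq_bigr => j _ /=; rewrite subrK.
rewrite (split_t (m \o s)) (split_t m) lerD2r.
have -> : psum (fun j => m j - t) k = \sum_j pos (m j).
  rewrite /psum big_mkcond; apply: eq_bigr => j _; rewrite /pos.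
  case: ltnP => jk.
    by have := m_dom j (Ordinal kn) (ltnW jk); rewrite -/t; lia.
  by have := m_dom (Ordinal kn) j jk; rewrite -/t; lia.
rewrite (reindex_inj (@perm_inj _ s)) /psum big_mkcond; apply: ler_sum => j _.
by rewrite /pos /=; case: ifP; lia.
Qed.

Section AcuteCone.
Variables (n : nat) (n_gt0 : (0 < n)%N).
Implicit Types (v mu : 'rV[int]_n) (rho : 'S_n) (a b c : int).
Local Notation res := (res n_gt0).
Local Notation ext := (ext n_gt0).
Local Notation refl := (refl n_gt0).

(* v is reached from the base alcove in the direction of the Weyl chamber in
   which the coordinates decrease with their rank rho. *)
Definition acute rho v := forall a b, a < b ->
  (rho (res a) < rho (res b))%N -> ext v b <= ext v a.

Definition displ i rho v (j : 'I_n) : int := (v - omega n i) 0 ((rho^-1)%g j).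

(** Induction on the total defect of the partial sums. For the pair l < r of [raising_pair], an
    upward reflection adds 1 to the displacement at l, subtracts 1 at r, and preserves acuteness. *)
Lemma acute_vleq i rho mu v : dominant mu -> acute rho v ->
  (forall k, psum (displ i rho v) k <= psum (mu 0) k) ->
  psum (displ i rho v) n = psum (mu 0) n ->
  vleq n_gt0 v (omega n i + col_perm rho mu).
Proof.
move=> mu_dom; pose D v k := psum (mu 0) k - psum (displ i rho v) k.
pose M v := \sum_(k < n) D v k.
have [m] := ubnP `|M v|%N; elim: m => // m IHm in v *; rewrite ltnS => hm ac le_mu eq_n.
have [neq|/forallNP eq_all] := pselect (exists k, psum (displ i rho v) k <> psum (mu 0) k);
  last first.
  have e : displ i rho v =1 mu 0.
    by apply: eq_psum => k; apply: contrapT; exact: eq_all.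
  have -> : omega n i + col_perm rho mu = v; last exact: rt_refl.
  apply/rowP => j; have := e (rho j).
  by rewrite /displ permK !mxE => <-; ring.
have displE a : ext v a = displ i rho v (rho (res a)) + ext (omega n i) a.
  by rewrite /displ permK /ext !mxE; ring.
(* Acuteness is applied to c and the next integer d in the class of the other coordinate; the base
   vertex drops by at most one within that period. *)
have near_dom (j k : 'I_n) : (j < k)%N -> displ i rho v k <= displ i rho v j + 1.
  move=> jk; have jn := ltn_ord ((rho^-1)%g j); have kn := ltn_ord ((rho^-1)%g k).
  pose c := ((rho^-1)%g j)%:Z.
  have [d [cd dc rd]] : exists d, [/\ c < d, d < c + n%:Z & res d = (rho^-1)%g k].
    have [cd|dc] := ltP c ((rho^-1)%g k)%:Z.
      by exists ((rho^-1)%g k)%:Z; rewrite res_ord; split=> //; rewrite /c; lia.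
    exists (((rho^-1)%g k)%:Z + 1 * n%:Z); rewrite res_shift res_ord; split=> //.
      by rewrite /c; lia.
    suff : ((rho^-1)%g k)%:Z != c by lia.
    apply/eqP => -[/val_inj/perm_inj kj]; by rewrite kj ltnn in jk.
  have := ac c d cd; rewrite !displE rd !res_ord !permKV => /(_ jk).
  have := ext_omega_ge n_gt0 i (ltW dc).
  have := ext_shift n_gt0 (omega n i) c 1; rewrite mul1r; lia.
have [l [r [lr lt_mu l_up r_down]]] := raising_pair mu_dom near_dom le_mu eq_n neq.
pose A := (rho^-1)%g l; pose B := (rho^-1)%g r.
have AB : A != B by rewrite (inj_eq perm_inj) -val_eqE neq_ltn lr.
(* In the class of B, [b] is the integer where [ext v] exceeds its value at [a] by one, so
   exchanging the two values changes each coordinate by one. Acuteness forces b < a. *)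
pose a := A%:Z; pose b := B%:Z + (v 0 B - v 0 A - 1) * n%:Z.
have ra : res a = A by rewrite res_ord.
have rb : res b = B by rewrite res_shift res_ord.
have eb : ext v b = ext v a + 1 by rewrite ext_shift !ext_ord; ring.
have rba : res b != res a by rewrite ra rb eq_sym.
have ba : b < a.
  rewrite ltNge le_eqVlt; apply/negP => /predU1P[ab|ab].
    by rewrite ab eqxx in rba.
  by have := ac a b ab; rewrite ra rb !permKV eb => /(_ lr); lia.
pose v' := act (refl b a) v.
have vv' : vleq n_gt0 v v'.
  by apply: rt_step; exists b, a; split=> //; rewrite eb; lia.
apply: rt_trans vv' _.
have ext'A c : res c = A -> ext v' c = ext v c + 1.
  rewrite -ra => /eqP /eq_resP[q ->].
  by rewrite /v' ext_act afun_shift afun_refl // swpR // !(ext_shift _ _ _ q) eb; ring.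
have ext'B c : res c = B -> ext v' c = ext v c - 1.
  rewrite -rb => /eqP /eq_resP[q ->].
  by rewrite /v' ext_act afun_shift afun_refl // swpL // !(ext_shift _ _ _ q) eb; ring.
have ext'C c : res c != A -> res c != B -> ext v' c = ext v c.
  move=> cA cB; rewrite /v' ext_act afun_refl // /swp rb ra.
  by rewrite (negbTE cA) (negbTE cB).
have displ' j : displ i rho v' j =
    displ i rho v j + ((j == l)%:R - (j == r)%:R).
  have e : displ i rho v' j = displ i rho v j +
      (ext v' ((rho^-1)%g j)%:Z - ext v ((rho^-1)%g j)%:Z).
    by rewrite /displ !ext_ord !mxE; ring.
  rewrite e; congr (_ + _).
  have [->|jl] := eqVneq j l.
    by rewrite ext'A ?res_ord // -val_eqE ltn_eqF // mulr1n mulr0n; ring.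
  have [->|jr] := eqVneq j r; first by rewrite ext'B ?res_ord // mulr1n mulr0n; ring.
  by rewrite ext'C ?res_ord ?(inj_eq perm_inj) // !mulr0n; ring.
have psum' k : psum (displ i rho v') k = psum (displ i rho v) k + (l < k <= r)%N%:R.
  rewrite /psum (eq_bigr _ (fun j _ => displ' j)) big_split /=; congr (_ + _).
  rewrite sumrB.
  have delta (p : 'I_n) : \sum_(j < n | (j < k)%N) (j == p)%:R = (p < k)%N%:R :> int.
    case: ltnP => pk.
      rewrite (bigD1 p) //= eqxx big1 ?addr0 // => j /andP[_ /negbTE ->]; exact: mulr0n.
    rewrite big1 // => j jk; case: eqP => [jp|//]; rewrite jp in jk; lia.
  rewrite !delta; move: lr; case: (ltnP l k); case: (ltnP r k) => //=; lia.
apply: IHm.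
- apply: leq_trans hm.
  have M_ge0 : 0 <= M v' .
    apply: sumr_ge0 => k _; rewrite subr_ge0 psum'.
    case: (boolP (l < k <= r)%N) => [/lt_mu|_] //=; last by rewrite addr0.
    by rewrite lezD1.
  suff : M v' < M v by lia.
  rewrite /M (bigD1 r) // [X in _ < X](bigD1 r) //=; apply: ltr_leD.
    by rewrite /D psum' lr leqnn /=; lia.
  by apply: ler_sum => k _; rewrite /D psum'; lia.
(* Acuteness could only break where the value at d grows or the value at c drops; there [l_up] and
   [r_down] supply the missing unit. *)
- move=> c d cd rcd.
  have om := ext_omega_ge n_gt0 i (ltW cd).
  have := ac c d cd rcd.
  have := displE c; have := displE d.
  have [dA|dA] := eqVneq (res d) A.
    have cA : res c != A.
      by apply: contraTneq rcd => ->; rewrite dA ltnn.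
    have cB : res c != B.
      by apply: contraTneq rcd => ->; rewrite dA !permKV -leqNgt ltnW.
    rewrite (ext'A d) // ext'C //.
    by rewrite dA permKV in rcd *; have := l_up _ rcd; lia.
  have [cB|cB] := eqVneq (res c) B.
    have dB : res d != B.
      by apply: contraTneq rcd => ->; rewrite cB ltnn.
    rewrite (ext'B c) // (ext'C d) //.
    by rewrite cB permKV in rcd *; have := r_down _ rcd; lia.
  have [dB|dB] := eqVneq (res d) B.
    rewrite (ext'B d) //; have [cA|cA] := eqVneq (res c) A.
      by rewrite (ext'A c) //; lia.
    by rewrite ext'C //; lia.
  rewrite (ext'C d) //; have [cA|cA] := eqVneq (res c) A.
    by rewrite (ext'A c) //; lia.
  by rewrite ext'C.
- move=> k; rewrite psum'; case: (boolP (l < k <= r)%N) => [/lt_mu|_] //=.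
    by rewrite lezD1.
  by rewrite addr0.
by rewrite psum' [(n <= r)%N]leqNgt (ltn_ord r) andbF addr0.
Qed.

End AcuteCone.

(** * Partial sums on the permutation polytope *)

Section PolytopePartialSums.
Variables (R : realType) (n : nat).
Implicit Types (mu w : 'rV[int]_n) (rho : 'S_n).

Lemma sum_psum rho (F : 'I_n -> int) k :
  \sum_j (rho j < k)%N%:R * (F j)%:~R = (psum (F \o (rho^-1)%g) k)%:~R :> R.
Proof.
rewrite (reindex_inj (@perm_inj _ rho^-1%g)) /psum [in RHS]big_mkcond rmorph_sum.
apply: eq_bigr => j _; rewrite permKV /=.
by case: ifP => _; rewrite ?mul1r ?mul0r.
Qed.

(** A partial sum in the order [rho] is a linear functional, hence bounded on the polytope by its
    values at the vertices, which [psum_perm] controls. *)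
Lemma orbit_polytope_psum mu w rho k : dominant mu ->
  orbit_polytope R mu (map_mx intr w) ->
  psum (w 0 \o (rho^-1)%g) k <= psum (mu 0) k.
Proof.
move=> mu_dom Pw; rewrite -(ler_int R) -sum_psum.
have := @orbit_polytope_le R n mu (fun j => (rho j < k)%N%:R) (psum (mu 0) k)%:~R _ _ Pw.
under eq_bigr do rewrite mxE; apply=> s.
rewrite (sum_psum rho (mu 0 \o s)) ler_int.
have -> : (mu 0 \o s) \o (rho^-1)%g = mu 0 \o (rho^-1 * s)%g.
  by apply/funext => j /=; rewrite permM.
exact: psum_perm.
Qed.

Lemma psum_full (F : 'I_n -> int) : psum F n = \sum_j F j.
Proof. by apply: eq_bigl => j; rewrite ltn_ord. Qed.

Lemma orbit_polytope_sum mu w : dominant mu ->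
  orbit_polytope R mu (map_mx intr w) -> \sum_j w 0 j = \sum_j mu 0 j.
Proof.
move=> mu_dom Pw; apply/eqP; rewrite eq_le; apply/andP; split.
  have := orbit_polytope_psum 1%g n mu_dom Pw; rewrite !psum_full invg1.
  by under eq_bigr do rewrite /= perm1.
have neg (F : 'I_n -> int) : \sum_j (-1) * (F j)%:~R = (- \sum_j F j)%:~R :> R.
  by rewrite -sumrN rmorph_sum; apply: eq_bigr => j _; rewrite mulN1r rmorphN.
rewrite -lerN2 -(ler_int R) -neg.
rewrite (eq_bigr (fun j => (-1) * (map_mx intr w : 'rV[R]_n) 0 j)); last first.
  by move=> j _; rewrite mxE.
apply: (@orbit_polytope_le R n mu (fun=> -1) _ _ _ Pw) => s.
by rewrite (neg (mu 0 \o s)) [in X in _ <= X](reindex_inj (@perm_inj _ s)).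
Qed.

End PolytopePartialSums.

(** * Faces as families of vertices, and the equality of the two sets *)

Section Main.
Variables (n : nat) (n_gt0 : (0 < n)%N).
Implicit Types (mu v : 'rV[int]_n) (x : affPerm n) (Ibar : {set 'I_n}).
Local Notation ext := (ext n_gt0).
Local Notation res := (res n_gt0).
Local Notation afun := (afun n_gt0).

Lemma ext_const v (q c : int) : ext (v + const_mx q) c = ext v c + q.
Proof. by rewrite /ext !mxE; ring. Qed.

Lemma sum_ltn_ord (r : nat) : (r <= n)%N ->
  \sum_(j < n) (if j%:Z < r%:Z then 1 else 0) = r%:Z.
Proof.
move=> rn; rewrite -big_mkcond /=.
transitivity (\sum_(j < n | (j < r)%N) (1 : int)); first by apply: eq_bigl.
by rewrite -(big_ord_widen n (fun=> 1 : int) rn) sumr_const card_ord; lia.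
Qed.

Lemma vsum_omega (i : int) : vsum (omega n i) = i.
Proof.
rewrite /vsum; under eq_bigr do rewrite mxE.
have rn : (`|(i %% n)%Z| <= n)%N by exact: ltnW (modz_ltn n_gt0 i).
rewrite big_split /= sumr_const card_ord.
have r0 : 0 <= (i %% n)%Z by apply: modz_ge0; lia.
have := sum_ltn_ord rn; rewrite gez0_abs // => ->.
by rewrite [RHS](divz_eq i n) -mulr_natr; congr (_ + _); congr (_ * _); lia.
Qed.

Lemma face_of_is_face Ibar x : is_face (@face_of n Ibar x).
Proof.
split=> [i j ij|i j ij c|i j]; rewrite /face_of.
- apply: (@ext_inj n n_gt0) => c; rewrite ext_const !ext_act !ext_omega ij.
  have -> : afun x c - (val i + n%:Z) = (-1) * n%:Z + (afun x c - val i) by ring.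
  by rewrite divzMDl; [ring|lia].
- rewrite -!(ext_ord n_gt0) !ext_act !ext_omega lerN2.
  by apply: lez_pdiv2r; rewrite ?lerD2l ?lerN2 //; lia.
have vsum_act k : vsum (act x (omega n k)) = vsum (transl x) + k.
  rewrite -[in RHS](vsum_omega k) /vsum [X in _ + X](reindex_inj (@perm_inj _ (linpart x))).
  by rewrite -big_split; apply: eq_bigr => c _; rewrite !mxE.
by rewrite !vsum_act; ring.
Qed.

(** A step is undone by a transfer of [ext p a - ext p b] between two coordinates of the
    displacement. The room for it is this amount plus [ext w a - ext w b], which is non-negative
    because a < b. *)
Lemma aleq_polytope (R : realType) mu x y (i : int) : aleq n_gt0 x y ->
  orbit_polytope R mu (map_mx intr (act y (omega n i) - omega n i)) ->
  orbit_polytope R mu (map_mx intr (act x (omega n i) - omega n i)).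
Proof.
elim=> {x y} [x y [a [b [ab rab xab ->]]]|//|x y z _ xy _ yz zP]; last exact: xy (yz zP).
rewrite ltrN2 in xab; rewrite actM; set p := act x (omega n i); set w := omega n i.
have pab : ext p b <= ext p a.
  by rewrite !ext_act; apply: ext_omega_ge; apply: ltW.
have wab : ext w b <= ext w a by apply: ext_omega_ge; apply: ltW.
move=> /(@orbit_polytope_transfer R n mu _ (res a) (res b) (ext p a - ext p b)%:~R rab).
set L := map_mx _ _.
have LE c : L 0 (res c) = (ext p (swp n_gt0 a b c) - ext w c)%:~R.
  by rewrite -afun_refl // -ext_act mxE ext_sub.
rewrite !LE swpL swpR // -rmorphB ler0z ler_int.
move=> /(_ ltac:(lia) ltac:(lia)).
congr (orbit_polytope R mu _); apply/rowP => j.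
have -> : (map_mx intr (p - w) : 'rV[R]_n) 0 j = (ext p j%:Z - ext w j%:Z)%:~R.
  by rewrite mxE -{1}(res_ord n_gt0 j) ext_sub.
rewrite mxE -{1}(res_ord n_gt0 j) LE /swp !mxE eqxx res_ord /=.
have [/eqP ja|ja] := eqVneq j (res a).
  have [q ->] : exists q : int, j%:Z = a + q * n by apply/(eq_resP n_gt0); rewrite res_ord.
  rewrite (eqP ja) (negbTE rab) (_ : a + q * n + (b - a) = b + q * n); last by ring.
  by rewrite !ext_shift mulr1n mulr0n subr0 mulr1 -rmorphD; congr (_%:~R); ring.
have [/eqP jb|jb] := eqVneq j (res b).
  have [q ->] : exists q : int, j%:Z = b + q * n by apply/(eq_resP n_gt0); rewrite res_ord.
  rewrite (_ : b + q * n + (a - b) = a + q * n); last by ring.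
  rewrite !ext_shift mulr1n mulr0n sub0r mulrN1 -rmorphB; congr (_%:~R); ring.
by rewrite subrr mulr0 addr0.
Qed.

Lemma face_shift Ibar (v : family Ibar) (i j : {i : int | preimZ Ibar i}) (q : int) :
  is_face v -> val j = val i + q * n -> v j = v i + const_mx q.
Proof.
case=> shift _ _.
have pos (k : nat) (i' j' : {i : int | preimZ Ibar i}) : val j' = val i' + k%:Z * n ->
    v j' = v i' + const_mx k%:Z.
  elim: k i' j' => [|k IHk] i' j' ij.
    have -> : j' = i' by apply/val_inj; rewrite ij mul0r addr0.
    by apply/rowP => c; rewrite !mxE addr0.
  have pk : preimZ Ibar (val i' + k%:Z * n).
    have /existsP[r /andP[rI e]] := valP i'; apply/existsP; exists r.
    by rewrite rI /= addrC modzMDl.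
  rewrite (shift (Sub _ pk)) ?SubK; last by rewrite ij; lia.
  rewrite (IHk i') ?SubK //; apply/rowP => c; rewrite !mxE; lia.
move=> ij; have [q0|q0] := leP 0 q.
  by have := pos `|q|%N i j; rewrite gez0_abs // => ->.
have := pos `|q|%N j i; rewrite ltz0_abs // => ->; last by rewrite ij; ring.
by apply/rowP => c; rewrite !mxE; ring.
Qed.

(** Periodicity squeezes v_j between v_i + q and v_i + q + 1. If v_i is strictly larger at a than at
    b, integrality makes v_j at a at least v_i(b) + q + 1, hence at least v_j at b. *)
Lemma face_noncrossing Ibar (v : family Ibar) : is_face v -> noncrossing n_gt0 v.
Proof.
move=> fv a b; apply: contrapT => /not_orP[/existsNP[i /negP] + /existsNP[j /negP]].
rewrite -!ltNge => lt_i lt_j.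
pose q := ((val j - val i) %/ n)%Z.
have pi' : preimZ Ibar (val i + q * n).
  have /existsP[r /andP[rI e]] := valP i; apply/existsP; exists r.
  by rewrite rI /= addrC modzMDl.
have pi'' : preimZ Ibar (val i + (q + 1) * n).
  have /existsP[r /andP[rI e]] := valP i; apply/existsP; exists r.
  by rewrite rI /= addrC modzMDl.
have e1 := face_shift fv (SubK _ pi') : v (Sub _ pi') = v i + const_mx q.
have e2 := face_shift fv (SubK _ pi'') : v (Sub _ pi'') = v i + const_mx (q + 1).
have [r [r0 rn jq]] : exists r : int, [/\ 0 <= r, r < n & val j = val i + q * n + r].
  exists ((val j - val i) %% n)%Z; split.
  - by apply: modz_ge0; lia.
  - by apply: ltz_pmod; lia.
  by have := divz_eq (val j - val i) n; rewrite -/q; lia.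
case: fv => _ mono _.
have le_ext u u' c : vle u u' -> ext u c <= ext u' c.
  by move=> uu'; rewrite /ext lerB.
have lo : vle (v i + const_mx q) (v j) by rewrite -e1; apply: mono; rewrite SubK jq lerDl.
have hi : vle (v j) (v i + const_mx (q + 1)).
  by rewrite -e2; apply: mono; rewrite SubK jq mulrDl mul1r addrA lerD2l ltW.
have := le_ext _ _ a lo; have := le_ext _ _ b lo.
have := le_ext _ _ a hi; have := le_ext _ _ b hi.
rewrite !ext_const; lia.
Qed.

(* Coordinates are ranked by the displacement n v_a + a of a single vertex;
   this is the Weyl chamber containing the direction from the base alcove to
   the face. *)
Lemma exists_acute (J : Type) (v : J -> 'rV[int]_n) (i0 : J) :
  noncrossing n_gt0 v -> exists rho : 'S_n, forall i, acute n_gt0 rho (v i).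
Proof.
move=> ncv; pose key c := n%:Z * ext (v i0) c + c.
have key_res c : key (res c)%:Z = key c.
  rewrite [in RHS](divz_res n_gt0 c) /key ext_shift; ring.
pose up (r : 'I_n) := [set s : 'I_n | key r%:Z < key s%:Z]%SET.
have up_lt r : (#|up r| < n)%N.
  rewrite -[X in (_ < X)%N]card_ord -cardsT; apply: proper_card.
  by apply/properP; split; [exact: finset.subsetT|exists r; rewrite ?inE ?ltxx].
have up_mono (r s : 'I_n) : key r%:Z < key s%:Z -> (#|up s| < #|up r|)%N.
  move=> rs; apply: proper_card; apply/properP; split.
    by apply/fintype.subsetP => t; rewrite !inE; exact: lt_trans.
  by exists s; rewrite ?inE ?ltxx.
have key_inj (r s : 'I_n) : key r%:Z = key s%:Z -> r = s.
  rewrite /key !ext_ord => e; apply/val_inj => /=.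
  have := ltn_ord r; have := ltn_ord s; move: (v i0 0 r) (v i0 0 s) e => y z e.
  by case: (ltgtP y z) e => [yz|zy|->]; nia.
have rk_inj : injective (fun r => Ordinal (up_lt r)).
  move=> r s /(congr1 val) /= rs; apply: key_inj.
  by case: (ltgtP (key r%:Z) (key s%:Z)) => // /up_mono; rewrite rs ltnn.
exists (perm rk_inj) => i a b ab; rewrite !permE /= => rk_ab.
have key_ab : key b < key a.
  rewrite -(key_res a) -(key_res b) ltNge le_eqVlt; apply/negP => /predU1P[/key_inj e|].
    by rewrite e ltnn in rk_ab.
  by move/up_mono; rewrite ltnNge (ltnW rk_ab).
(* As a < b, the larger key at a forces a strictly larger value of [ext (v i0)] there, which decides
   the side for the whole family. *)
have [h|//] := ncv a b.
by have := h i0; move: key_ab; rewrite /key; nia.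
Qed.

End Main.

Theorem corollary7p6 (R : realType) (n : nat) (n_gt0 : (0 < n)%N)
    (mu : 'rV[int]_n) (mu_dom : dominant mu)
    (Ibar : {set 'I_n}) (Ibar_neq0 : Ibar != finset.set0) :
  PermI R Ibar mu = AdmI Ibar mu.
Proof.
apply/seteqP; split=> [v [fv Pv]|_ [x [s /(bruhat_aleq n_gt0) xs] <-]]; last first.
  split; first exact: face_of_is_face.
  move=> i; apply: aleq_polytope xs _.
  have -> : act (translation (col_perm s mu)) (omega n (val i)) - omega n (val i) = col_perm s mu.
    by apply/rowP => j; rewrite !mxE perm1 addrK.
  exact: orbit_polytope_vertex.
have ncv := face_noncrossing n_gt0 fv.
(* Non-emptiness of [Ibar] provides the vertex whose direction fixes one [rho] for all indices. *)
have [r rI] := finset.set0Pn _ Ibar_neq0.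
have pr : preimZ Ibar r%:Z by apply/existsP; exists r; rewrite rI /=.
have [rho ac] := exists_acute (Sub _ pr) ncv.
have vy i : vleq n_gt0 (v i) (act (translation (col_perm rho mu)) (omega n (val i))).
  have -> : act (translation (col_perm rho mu)) (omega n (val i)) =
      omega n (val i) + col_perm rho mu.
    by apply/rowP => j; rewrite !mxE perm1 addrC.
  apply: acute_vleq => // [k|].
    exact: orbit_polytope_psum mu_dom (Pv i).
  rewrite !psum_full -(orbit_polytope_sum mu_dom (Pv i)).
  by rewrite [RHS](reindex_inj (@perm_inj _ (rho^-1)%g)).
have [x xy xE] := lift_family ncv vy.
exists x; first by exists rho; exact: aleq_bruhat xy.
by apply/funext => i; rewrite xE.
Qed.
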